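(* Let $X$ be an infinite discrete space, and let $G$ be a subgroup of the permutation group $({\rm S}(X),\tau_p)$ whose action on $X$ is ultratransitive. Then $$b_rG=e_{\alpha X}G=b_{\alpha X}G=b_XG.$$
   Context: $\tau_p$ is the topology of pointwise convergence (permutation topology), with subbase $\{g\mid g(x)=y\}$, $x,y\in X$. The action of $G$ on $X$ is ultratransitive if for every $n$ and all pairwise distinct $x_1,\dots,x_n$ and pairwise distinct $y_1,\dots,y_n$ in $X$ there is $g\in G$ with $g(x_i)=y_i$, $i=1,\dots,n$. $\alpha X=X\cup\{\infty\}$ is the Alexandroff one-point compactification, on which $G$ acts fixing $\infty$. Compactifications of $G$ (all below are proper, i.e. contain $G$ as a dense topologically embedded subspace): - $b_rG$, the Roelcke compactification: the Samuel compactification of $G$ with respect to the Roelcke uniformity $L\wedge R$, whose base is the covers $\{OgO\mid g\in G\}$, $O$ a neighbourhood of $e$. - $e_{\alpha X}G$, the Ellis compactification: the closure of $\{x\mapsto gx\mid g\in G\}$ in $(\alpha X)^{\alpha X}$ with the product topology. - For $Z=X$ or $Z=\alpha X$, $b_ZG$, the graph compactification: the closure of $\{\imath_Z^{\Gamma}(g)=\{(z,gz)\mid z\in Z\}\mid g\in G\}$ in the space $2^{Z\times Z}$ of all closed subsets of $Z\times Z$ (including $\emptyset$) with the Fell topology, whose subbase is all sets $\{F\mid F\cap W\neq\emptyset\}$, $W$ open, and $\{F\mid F\cap K=\emptyset\}$, $K$ compact. Equality of compactifications means existence of a homeomorphism between them commuting with the embeddings of $G$. *)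

(* Defs.v *)
From HB Require Import structures.
From mathcomp Require Import all_boot all_order all_algebra.
From mathcomp Require Import finmap all_classical all_reals all_analysis.
Import Order.TTheory GRing.Theory Num.Theory numFieldNormedType.Exports.

Set Implicit Arguments.
Unset Strict Implicit.
Unset Printing Implicit Defensive.

Local Open Scope classical_set_scope.

HB.mixin Record isTopologicalGroup G & Group G & Topological G := {
  mulg_continuous : continuous (fun p : G * G => (p.1 * p.2)%g) ;
  invg_continuous : continuous (fun g : G => (g^-1)%g) ;
}.

#[short(type="topologicalGroupType")]
HB.structure Definition TopologicalGroup :=
  {G of isTopologicalGroup G & Group G & Topological G}.

Section TopologicalGroupTheory.
Context {G : topologicalGroupType} {T : Type} (F : set_system T).
Context {FF : Filter F}.
Implicit Types (f h : T -> G) (a b : G).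

Lemma cvgMg f h a b : f @ F --> a -> h @ F --> b ->
  (fun x => f x * h x)%g @ F --> (a * b)%g.
Proof.
move=> fa hb; apply: (@continuous2_cvg T G G G F FF f h _ a b) => //.
exact: (@mulg_continuous G (a, b)).
Qed.

Lemma cvgVg f a : f @ F --> a -> (fun x => (f x)^-1)%g @ F --> (a^-1)%g.
Proof.
by move=> fa; apply: (@continuous_cvg T G G F FF f _ a) => //;
  exact: (@invg_continuous G a).
Qed.

End TopologicalGroupTheory.

Section Subgroup.
Context {T : topologicalGroupType}.

Definition subgroup (G : groupClosed T) : Type := {g : T | g \in G}.

Variable G : groupClosed T.
Local Notation H := (subgroup G).

HB.instance Definition _ := SubChoice.on H.

Let subgroup_group_closed : group_closed (fun g => g \in G).
Proof.
split; first exact: gpred1.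
by move=> x y xG yG; apply: gpredM => //; exact: gpredVr.
Qed.

HB.instance Definition _ :=
  SubChoice_isSubGroup.Build T (fun g => g \in G) H subgroup_group_closed.

HB.instance Definition _ := Topological.copy H (initial_topology (val : H -> T)).

Lemma subgroup_val_continuous : continuous (val : H -> T).
Proof. exact: initial_continuous. Qed.

Lemma subgroup_continuous (S : topologicalType) (f : S -> H) :
  continuous (val \o f) -> continuous f.
Proof.
by move=> cf; exact: (@continuous_comp_initial H S T val f cf).
Qed.

End Subgroup.

Section SubgroupTopology.
Context {T : topologicalGroupType} (G : groupClosed T).
Local Notation H := (subgroup G).

Let subgroup_mulg_continuous : continuous (fun p : H * H => (p.1 * p.2)%g).
Proof.
apply: subgroup_continuous => p.
apply: (cvgMg (f := fun q : H * H => val q.1) (h := fun q : H * H => val q.2)).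
- by apply: (@continuous_comp _ _ _ fst (val : H -> T));
    [exact: cvg_fst|exact: subgroup_val_continuous].
- by apply: (@continuous_comp _ _ _ snd (val : H -> T));
    [exact: cvg_snd|exact: subgroup_val_continuous].
Qed.

Let subgroup_invg_continuous : continuous (fun g : H => (g^-1)%g).
Proof.
apply: subgroup_continuous => g.
rewrite (_ : _ \o _ = (fun u : T => (u^-1)%g) \o (val : H -> T)); last first.
  by apply/funext => u.
apply: continuous_comp; first exact: subgroup_val_continuous.
exact: invg_continuous.
Qed.

HB.instance Definition _ := isTopologicalGroup.Build H
  subgroup_mulg_continuous subgroup_invg_continuous.

End SubgroupTopology.

Definition roelcke (G : Type) : Type := G.

Section Roelcke.
Context {G : topologicalGroupType}.
Implicit Types (O V : set G) (g : G).

Definition dcoset O g : set G := [set (a * g * b)%g | a in O & b in O].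

(* The cover {O g O | g} of G, as the relation "lying in a common member". *)
Definition dcoset_rel O : set (roelcke G * roelcke G) :=
  [set p | exists g, dcoset O g p.1 /\ dcoset O g p.2].

(* The meet of the left and right uniformities.  It induces the topology of G,
   see [roelcke_nbhsE]. *)
Definition roelcke_entourage : set_system (roelcke G * roelcke G) :=
  filter_from (nbhs (1%g : G)) dcoset_rel.

Lemma nbhs1_div O : nbhs (1%g : G) O -> exists2 V, nbhs (1%g : G) V &
  forall a b, V a -> V b -> O (a * b^-1)%g /\ O (a^-1 * b)%g.
Proof.
move=> nO.
have c1 : (fun p : G * G => p.1 * p.2^-1)%g @ (1%g, 1%g) --> (1%g : G).
  rewrite -[X in _ --> X](mulgV (1%g : G)).
  by apply: cvgMg; [exact: cvg_fst|apply: cvgVg; exact: cvg_snd].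
have c2 : (fun p : G * G => p.1^-1 * p.2)%g @ (1%g, 1%g) --> (1%g : G).
  rewrite -[X in _ --> X](mulVg (1%g : G)).
  by apply: cvgMg; [apply: cvgVg; exact: cvg_fst|exact: cvg_snd].
have [[A1 B1] [/= nA1 nB1] s1] := c1 _ nO.
have [[A2 B2] [/= nA2 nB2] s2] := c2 _ nO.
exists ((A1 `&` B1) `&` (A2 `&` B2)); first by do 2 apply: filterI.
move=> a b [] [? ?] [? ?] [] [? ?] [? ?].
by split; [exact: (s1 (a, b))|exact: (s2 (a, b))].
Qed.

HB.instance Definition _ := Topological.copy (roelcke G) G.

Local Open Scope relation_scope.

Let roelcke_filter : Filter roelcke_entourage.
Proof.
apply: filter_from_filter; first by exists setT; exact: filterT.
move=> A B nA nB; exists (A `&` B); first exact: filterI.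
move=> p [g [] [a [Aa Ba] [b [Ab Bb] eab]] [c [Ac Bc] [d [Ad Bd] ecd]]].
by split; exists g; split; [exists a => //; exists b|exists c => //; exists d
  |exists a => //; exists b|exists c => //; exists d].
Qed.

Let roelcke_diagonal A : roelcke_entourage A -> diagonal `<=` A.
Proof.
move=> [W /nbhs_singleton W1 WA] [x y] /diagonalP ->; apply: WA; exists y.
by split; exists 1%g => //; exists 1%g => //; rewrite mul1g mulg1.
Qed.

Let roelcke_inv A : roelcke_entourage A -> roelcke_entourage A^-1.
Proof.
by move=> [W nO WA]; exists W => // -[x y] [g [/= xg yg]]; apply: WA; exists g.
Qed.

Let roelcke_split A :
  roelcke_entourage A -> exists2 B, roelcke_entourage B & B \; B `<=` A.
Proof.
move=> [W nW WA]; have [V nV VW] := nbhs1_div nW.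
exists (dcoset_rel V); first by exists V.
move=> [x z] [y /=] [g [] [a1 Va1 [b1 Vb1 xE]] [a Va [b Vb yE]]].
case=> [h [] [c Vc [d Vd yE']] [c1 Vc1 [d1 Vd1 zE]]].
rewrite /= in xE yE yE' zE.
apply: WA; exists y; split => /=.
- exists (a1 * a^-1)%g; first exact: (VW _ _ Va1 Va).1.
  exists (b^-1 * b1)%g; first exact: (VW _ _ Vb Vb1).2.
  by rewrite -xE -yE !mulgA mulgVK mulgK.
- exists (c1 * c^-1)%g; first exact: (VW _ _ Vc1 Vc).1.
  exists (d^-1 * d1)%g; first exact: (VW _ _ Vd Vd1).2.
  by rewrite -zE -yE' !mulgA mulgVK mulgK.
Qed.

Let roelcke_nbhsE : @nbhs _ (roelcke G) = nbhs_ roelcke_entourage.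
Proof.
apply/funext => x; apply/seteqP; split => U.
- move=> nU; have cx : (fun p : G * G => p.1 * x * p.2)%g @ (1%g, 1%g) --> x.
    rewrite -[X in _ --> X](mulg1 x) -[X in _ --> (X * _)%g](mul1g x).
    apply: cvgMg; last exact: cvg_snd.
    by apply: cvgMg; [exact: cvg_fst|exact: cvg_cst].
  have [[A B] [/= nA nB] sU] := cx _ nU.
  have [V nV VO] := nbhs1_div (filterI nA nB).
  exists (dcoset_rel V); first by exists V.
  move=> y /xsectionP /= [g [] [a Va [b Vb xE]] [c Vc [d Vd yE]]].
  rewrite /= in xE yE.
  have -> : y = (c * a^-1 * x * (b^-1 * d))%g.
    by rewrite -xE -yE !mulgA mulgVK mulgK.
  apply: (sU (c * a^-1, b^-1 * d)%g); split => /=.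
    exact: (VO _ _ Vc Va).1.1.
  exact: (VO _ _ Vb Vd).2.2.
- move=> [E [W nW WE] EU].
  have cx : (fun y : G => y * x^-1)%g @ (x : G) --> (1%g : G).
    rewrite -[X in _ --> X](mulgV (x : G)).
    by apply: cvgMg; [exact: cvg_id|exact: cvg_cst].
  have nW1 := nbhs_singleton nW.
  have := cx _ nW; apply: (@filterS G (nbhs (x : G)) _) => y Wy; apply: EU; apply/xsectionP; apply: WE.
  exists x; split => /=.
    by exists 1%g => //; exists 1%g => //; rewrite mul1g mulg1.
  by exists (y * x^-1)%g => //; exists 1%g => //; rewrite mulg1 mulgVK.
Qed.

HB.instance Definition _ := Nbhs_isUniform_mixin.Build (roelcke G)
  roelcke_filter roelcke_diagonal roelcke_inv roelcke_split roelcke_nbhsE.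

End Roelcke.

(* A space with a map from G.  Properness, compactness and the Hausdorff
   property are not imposed. *)
Record extension (G : Type) := Extension {
  ext_space :> topologicalType ;
  ext_map : G -> ext_space
}.
Arguments ext_map {G} _ _.

Definition ext_eq (G : Type) (c1 c2 : extension G) : Prop :=
  exists (f : c1 -> c2) (f' : c2 -> c1),
    [/\ continuous f, continuous f', cancel f f', cancel f' f
      & forall g, f (ext_map c1 g) = ext_map c2 g].

Section ClosureExtension.
Context {G : Type} {T : topologicalType} (e : G -> T).

Lemma closure_range g : e g \in closure (range e).
Proof. by rewrite inE; apply: subset_closure; exists g. Qed.

Definition closure_ext : extension G :=
  @Extension G (closure (range e)) (fun g => exist _ (e g) (closure_range g)).

End ClosureExtension.

(* The Samuel compactification of U: the closure of the diagonal image of U in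
   the product of copies of [0, 1] indexed by all uniformly continuous maps
   from U to [0, 1] (the product is taken inside a power of R). *)
Section Samuel.
Context (R : realType) (U : uniformType).

Definition unif_fun : Type :=
  [set f : U -> R | unif_continuous f /\ forall x, (0 <= f x <= 1)%R].

Definition samuel_map (x : U) : prod_topology (fun _ : unif_fun => R) :=
  fun f => val f x.

Definition samuel : extension U := closure_ext samuel_map.

End Samuel.

Definition roelcke_ext (R : realType) (G : topologicalGroupType) : extension G :=
  samuel R (roelcke G).

Definition ellis_ext (H : Type) (Z : topologicalType) (act : H -> Z -> Z) :
    extension H :=
  closure_ext (fun g => act g : prod_topology (fun _ : Z => Z)).

Record hyperspace (T : topologicalType) := Hyperspace {
  hyper_set :> set T ;
  hyper_closed : closed hyper_set
}.

Section Fell.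
Context {T : topologicalType}.

HB.instance Definition _ := gen_eqMixin (hyperspace T).
HB.instance Definition _ := gen_choiceMixin (hyperspace T).

Definition fell_subbase : set (set (hyperspace T)) :=
  [set [set F : hyperspace T | F `&` W !=set0] | W in @open T] `|`
  [set [set F : hyperspace T | F `&` K = set0] | K in @compact T].

HB.instance Definition _ :=
  isSubBaseTopological.Build (hyperspace T) fell_subbase id.

End Fell.

Section Graph.
Context {Z : topologicalType}.

Definition graph (f : Z -> Z) : set (Z * Z) := [set (z, f z) | z in [set: Z]].

Lemma graph_closed (f : Z -> Z) :
  hausdorff_space Z -> continuous f -> closed (graph f).
Proof.
rewrite open_hausdorff => hZ cf.
rewrite -openC openE => -[x y] nxy.
have /hZ[[A B] /= [xA yB] [oA oB /eqP AB0]] : f x != y.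
  by apply/eqP => fxy; apply: nxy; exists x => //; rewrite fxy.
exists (f @^-1` A, B); first split => /=.
- by apply: cf; apply: open_nbhs_nbhs; split => //; exact: set_mem.
- by apply: open_nbhs_nbhs; split => //; exact: set_mem.
move=> [u v] /= [Afu Bv] [w _ [wu wv]]; subst.
by have : (A `&` B) (f u) by []; rewrite AB0.
Qed.

Definition graph_ext (H : Type) (act : H -> Z -> Z) (hZ : hausdorff_space Z)
    (actc : forall g, continuous (act g)) : extension H :=
  closure_ext (fun g => Hyperspace (graph_closed hZ (actc g))).

End Graph.

(* [perm_inv] is determined by [perm_fun], see [permutationP]. *)
Record permutation (X : Type) := Permutation {
  perm_fun :> X -> X ;
  perm_inv : X -> X ;
  perm_funK : cancel perm_fun perm_inv ;
  perm_invK : cancel perm_inv perm_fun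
}.

Section Permutation.
Context {X : Type}.
Implicit Types g h : permutation X.

HB.instance Definition _ := gen_eqMixin (permutation X).
HB.instance Definition _ := gen_choiceMixin (permutation X).

Lemma permutationP g h : g =1 h -> g = h.
Proof.
case: g h => [f f' fK f'K] [k k' kK k'K] /= /funext fk; subst k.
have /funext ff' : f' =1 k' by move=> x; rewrite -{1}(k'K x) fK.
by subst k'; congr Permutation; exact: Prop_irrelevance.
Qed.

Definition permutation_one : permutation X :=
  @Permutation X id id (fun=> erefl) (fun=> erefl).

Definition permutation_mul g h : permutation X :=
  Permutation (can_comp (perm_funK g) (perm_funK h))
    (can_comp (perm_invK h) (perm_invK g)).

Definition permutation_inv g : permutation X := Permutation (perm_invK g) (perm_funK g).

Let permMA : associative permutation_mul. Proof. by move=> ? ? ?; exact: permutationP. Qed.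

Let perm1M : left_id permutation_one permutation_mul. Proof. by move=> ?; exact: permutationP. Qed.

Let permM1 : right_id permutation_one permutation_mul. Proof. by move=> ?; exact: permutationP. Qed.

Let permVM : left_inverse permutation_one permutation_inv permutation_mul.
Proof. by move=> g; apply: permutationP => x; exact: perm_funK. Qed.

Let permMV : right_inverse permutation_one permutation_inv permutation_mul.
Proof. by move=> g; apply: permutationP => x; exact: perm_invK. Qed.

HB.instance Definition _ :=
  isGroup.Build (permutation X) permMA perm1M permM1 permVM permMV.

Definition perm_subbase : set (set (permutation X)) :=
  [set A | exists x y, A = [set g : permutation X | g x = y]].

HB.instance Definition _ :=
  isSubBaseTopological.Build (permutation X) perm_subbase id.

Lemma nbhs_perm g (A : set (permutation X)) : nbhs g A <->
  exists s : seq X, forall h, map h s = map g s -> A h.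
Proof.
split.
  move=> [B [[D sD <-] [C DC gC] BA]].
  have [E EP EC] := sD _ DC.
  have fin (l : seq (set (permutation X))) :
      (forall i, i \in l -> perm_subbase i) -> (forall i, i \in l -> i g) ->
      exists s : seq X, forall h, map h s = map g s -> forall i, i \in l -> i h.
    elim: l => [|i l IH] sE gE; first by exists [::].
    have [j jl|j jl|s sP] := IH.
    - by apply: sE; rewrite inE jl orbT.
    - by apply: gE; rewrite inE jl orbT.
    have [x [y iE]] := sE i (mem_head _ _).
    have gi : i g by apply: gE; rewrite mem_head.
    exists (x :: s) => h [hx hs] j.
    rewrite inE => /orP[/eqP ->|jl]; last exact: sP.
    by move: gi; rewrite iE /= hx.
  have [i /EP|i iE|s sP] := fin (enum_fset E).
  - by rewrite inE.
  - by move: gC; rewrite -EC; exact.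
  have {}sP h : map h s = map g s -> C h.
    by move=> hs; rewrite -EC => i iE; exact: sP iE.
  by exists s => h /sP Ch; apply: BA; exists C.
move=> [s sA]; apply: (@filterS _ _ _ _ _ sA).
elim: s {sA} => [|x s IH]; first exact: filterS filterT.
have : nbhs g [set h : permutation X | h x = g x].
  exists [set h : permutation X | h x = g x]; split => //.
  exists [set [set h : permutation X | h x = g x]]; last by rewrite bigcup_set1.
  move=> _ ->; exists [fset [set h : permutation X | h x = g x]]%fset.
    by move=> i /fset1P ->; rewrite inE; exists x, (g x).
  by rewrite set_fset1 bigcap_set1.
by move=> nx; apply: filterS (filterI nx IH) => h [/= -> ->].
Qed.

Let perm_mulg_continuous :
  continuous (fun p : permutation X * permutation X => (p.1 * p.2)%g).
Proof.
move=> [g h] A /nbhs_perm[s sA]; rewrite nbhs_simpl.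
exists ([set k : permutation X | map k (map h s) = map g (map h s)],
        [set k : permutation X | map k s = map h s]).
  by split; apply/nbhs_perm; [exists (map h s)|exists s].
move=> [k l] /= [kP lP]; apply: sA.
elim: s kP lP => [|x s IH] //= [kx ks] [lx ls].
by rewrite IH // lx kx.
Qed.

Let perm_invg_continuous : continuous (fun g : permutation X => (g^-1)%g).
Proof.
move=> g A /nbhs_perm[s sA]; rewrite nbhs_simpl; apply/nbhs_perm.
exists (map (perm_inv g) s) => h hP; apply: sA.
elim: s hP => [|x s IH] //= [hx hs].
rewrite IH //; congr (_ :: _).
by apply: (can_inj (perm_funK h)); rewrite /= perm_invK hx perm_invK.
Qed.

HB.instance Definition _ := isTopologicalGroup.Build (permutation X)
  perm_mulg_continuous perm_invg_continuous.

Definition ultratransitive (G : groupClosed (permutation X)) : Prop :=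
  forall (n : nat) (x y : 'I_n -> X), injective x -> injective y ->
    exists2 g : permutation X, g \in G & forall i, g (x i) = y i.

End Permutation.

Section OnePoint.
Context {X : discreteTopologicalType}.
Local Notation aX := (one_point_compactification X).

Definition perm_opc (g : permutation X) : aX -> aX := omap g.

Lemma perm_continuous (g : permutation X) : continuous g.
Proof.
by move=> x A; rewrite !nbhs_principalE => /principal_filterP gA;
  exact/principal_filterP.
Qed.

Lemma perm_opc_continuous (g : permutation X) : continuous (perm_opc g).
Proof.
move=> [x|] A; first exact: perm_continuous.
move=> [K [cK _] KA]; exists (perm_inv g @` K).
  split; last exact: discrete_closed.
  apply: continuous_compact cK; apply: continuous_subspaceT.
  exact: (@perm_continuous (g^-1)%g).
move=> _ [[y nKy <-]|->]; apply: KA; last by right.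
by left; exists (g y) => // Kgy; apply: nKy; exists (g y) => //; exact: perm_funK.
Qed.

Lemma opc_hausdorff : hausdorff_space aX.
Proof.
have sep (x : X) (y : aX) : Some x != y ->
    nbhs (Some x : aX) [set Some x] /\ nbhs y (~` [set (Some x : aX)]).
  move=> xy; split; first by apply: filterS (discrete_set1 x) => _ ->.
  case: y xy => [y|_] /=.
    by move=> xy; apply: filterS (discrete_set1 y) => _ -> /esym/eqP; exact/negP.
  exists [set x]; first by split; [exact: compact_set1|exact: discrete_closed].
  by move=> _ [[z zx <-]|->] //= [].
move=> p q pq; apply: contrapT => /eqP npq; case: p q pq npq => [x|] q pq npq.
  by have [nx ny] := sep x q npq; have [z [-> /(_ erefl)]] := pq _ _ nx ny.
case: q npq pq => [x|] // npq pq; have [//|nx ny] := sep x None.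
by have [z [+ zx]] := pq _ _ ny nx; rewrite zx => /(_ erefl).
Qed.

End OnePoint.

Section PermutationExtensions.
Context (X : discreteTopologicalType) (G : groupClosed (permutation X)).

Definition ellis_opc : extension (subgroup G) :=
  ellis_ext (fun g : subgroup G => perm_opc (val g)).

Definition graph_opc : extension (subgroup G) :=
  graph_ext opc_hausdorff (fun g : subgroup G => @perm_opc_continuous X (val g)).

Definition graph_discrete : extension (subgroup G) :=
  graph_ext discrete_hausdorff (fun g : subgroup G => @perm_continuous X (val g)).

End PermutationExtensions.

(* Main.v *)
(* All four compactifications are the closure of G in R^(X * X) under
   g |-> ((x, y) |-> [g x = y]).  Each of them is compact and maps continuously to
   R^(X * X) by reading off these bits, so it is enough that the bits separate
   its points.
   - Ellis: a limit of elements of G fixes oo, and its value at x is y when the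
     bit (x, y) is 1, and oo when no such y exists.
   - Graphs in aX * aX: the limits F contain (oo, oo), meet every line {x} * aX and
     aX * {y}, and meet such a line only at (x, y) when (x, y) is in F; hence the
     points of F at infinity are determined by its trace on X * X.
   - Roelcke: if g and h have the same bits on A * A for a finite A, then by
     ultratransitivity h lies in O g O for the pointwise stabilizer O of A.  Hence
     a Roelcke uniformly continuous function is, up to any e > 0, a function of
     finitely many bits. *)
Require Import Defs.
From mathcomp Require Import all_boot all_order all_algebra.
From mathcomp Require Import finmap all_classical all_reals all_analysis.
From mathcomp Require Import ring lra.
Import Order.TTheory GRing.Theory Num.Theory numFieldNormedType.Exports.

Local Open Scope classical_set_scope.

(** * Closures, products and the comparison of extensions *)

Lemma closure_range_sub {S : Type} {T : topologicalType} (e : S -> T) (C : set T) :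
  closed C -> (forall s, C (e s)) -> closure (range e) `<=` C.
Proof.
by move=> cC eC; rewrite closureE; apply: smallest_sub => // _ [s _ <-].
Qed.

Lemma eval_continuous {I : Type} (T : I -> topologicalType) (i : I) :
  continuous (fun f : prod_topology T => f i).
Proof. exact: (@proj_continuous {classic I} T i). Qed.

Lemma prod_topology_continuous {I : Type} {S : topologicalType}
    {T : I -> topologicalType} (f : S -> prod_topology T) :
  (forall i, continuous (fun x => f x i)) -> continuous f.
Proof.
move=> cf x; apply/cvg_sup => i.
exact: (@continuous_comp_initial _ _ _ (fun h : forall i, T i => h i) f (cf i) x).
Qed.

Lemma prod_topology_hausdorff {I : Type} (T : I -> topologicalType) :
  (forall i, hausdorff_space (T i)) -> hausdorff_space (prod_topology T).
Proof. exact: (@hausdorff_product {classic I} T). Qed.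

Lemma prod_topology_compact {I : Type} (T : I -> topologicalType)
    (A : forall i, set (T i)) :
  (forall i, compact (A i)) ->
  compact [set f : prod_topology T | forall i, A i (f i)].
Proof. exact: (@tychonoff {classic I} T A). Qed.

Lemma clopen_natr_continuous (R : realType) (T : topologicalType) (b : T -> bool) :
  clopen [set x | b x] -> continuous (fun x => (b x)%:R : R)%R.
Proof.
move=> [ob cb] x; apply: cvg_near_cst.
have [bx|/negP nbx] := boolP (b x).
  by apply: filterS (open_nbhs_nbhs (conj ob bx)) => y /= ->.
have := open_nbhs_nbhs (conj (closed_openC cb) nbx).
by apply: filterS => y /negP/negbTE ->.
Qed.

Lemma ext_eq_sym {G : Type} (c1 c2 : extension G) : ext_eq c1 c2 -> ext_eq c2 c1.
Proof.
by move=> [f [f' [cf cf' fK f'K fe]]]; exists f', f; split => // g; rewrite -fe fK.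
Qed.

Lemma ext_eq_trans {G : Type} (c1 c2 c3 : extension G) :
  ext_eq c1 c2 -> ext_eq c2 c3 -> ext_eq c1 c3.
Proof.
move=> [f [f' [cf cf' fK f'K fe]]] [h [h' [ch ch' hK h'K he]]].
exists (h \o f), (f' \o h'); split.
- by move=> x; apply: continuous_comp; [exact: cf|exact: ch].
- by move=> x; apply: continuous_comp; [exact: ch'|exact: cf'].
- exact: can_comp.
- exact: can_comp.
- by move=> g; rewrite /= fe he.
Qed.

(** On the compact closure of [range e] the map [phi] is closed, because [T] is Hausdorff. Its image
    is therefore closed and contains the range of [e'], and closedness of [phi] is exactly
    continuity of its inverse. *)
Lemma closure_ext_eq {G : Type} {S T : topologicalType} (e : G -> S) (e' : G -> T)
    (phi : S -> T) :
  hausdorff_space T -> compact (closure (range e)) -> continuous phi ->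
  (forall p q, closure (range e) p -> closure (range e) q ->
    phi p = phi q -> p = q) ->
  (forall g, phi (e g) = e' g) ->
  ext_eq (closure_ext e) (closure_ext e').
Proof.
set K := closure (range e); set L := closure (range e').
move=> hT cK cphi phiI phie.
have phiKcl C : closed C -> closed (phi @` (K `&` C)).
  move=> cC; apply: compact_closed => //; apply: continuous_compact.
    exact: continuous_subspaceT.
  exact: compact_closedI.
have phiKL p : K p -> L (phi p).
  apply: (@closure_range_sub _ _ e (phi @^-1` L)).
    by apply: preimage_closed => //; exact: closed_closure.
  by move=> g /=; rewrite phie; apply: subset_closure; exists g.
have LphiK q : L q -> (phi @` K) q.
  apply: closure_range_sub => [|g].
    by rewrite -(setIT K); exact: phiKcl closedT.
  by exists (e g) => //; apply: subset_closure; exists g.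
pose f (p : K) : L := exist _ (phi (val p)) (mem_set (phiKL _ (set_mem (valP p)))).
pose r (q : L) := cid2 (LphiK _ (set_mem (valP q))).
pose f' (q : L) : K := exist _ (s2val (r q)) (mem_set (s2valP (r q))).
have f'K : cancel f' f by move=> q; apply: val_inj => /=; exact: (s2valP' (r q)).
have fK : cancel f f'.
  move=> p; apply: val_inj; apply: phiI.
  - exact: (set_mem (valP (f' (f p)))).
  - exact: (set_mem (valP p)).
  - exact: (congr1 val (f'K (f p))).
exists f, f'; split => //.
- apply: (@continuous_comp_initial _ _ _ (set_val : L -> T) f) => p.
  apply: (@continuous_comp K S T (set_val : K -> S) phi p); last exact: cphi.
  exact: (@initial_continuous K S set_val).
- apply: (@continuous_comp_initial _ _ _ (set_val : K -> S) f').
  apply/continuous_closedP => C cC.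
  (* Injectivity of [phi] on [K] identifies this preimage with the trace on [L] of a closed set. *)
  rewrite (_ : _ @^-1` C = (set_val : L -> T) @^-1` (phi @` (K `&` C))).
    apply: preimage_closed; last exact: phiKcl.
    by move=> q _; exact: (@initial_continuous L T set_val).
  apply/seteqP; split => q.
    move=> Cq; exists (val (f' q)); last exact: (congr1 val (f'K q)).
    by split; first exact: (set_mem (valP (f' q))).
  move=> [p [Kp Cp] pq]; suff rp : s2val (r q) = p by move: Cp; rewrite -rp.
  by apply: phiI => //; [exact: (s2valP (r q))|rewrite pq; exact: (s2valP' (r q))].
- by move=> g; apply: val_inj; rewrite /= phie.
Qed.

(** * The Fell topology: point tests and compactness *)

Section FellSpace.
Context {T : topologicalType}.
Implicit Types F : hyperspace T.

Lemma hyperspace_inj F F' : hyper_set F = hyper_set F' -> F = F'.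
Proof.
case: F F' => [A cA] [B cB] /= AB; subst B.
by congr Hyperspace; exact: Prop_irrelevance.
Qed.

Lemma fell_subbase_open (A : set (hyperspace T)) : fell_subbase A -> open A.
Proof.
move=> sA; exists [set A]; last by rewrite bigcup_set1.
move=> _ ->; exists [fset A]%fset; first by move=> i /fset1P ->; rewrite inE.
by rewrite set_fset1 bigcap_set1.
Qed.

Lemma fell_hit_open (W : set T) : open W -> open [set F : hyperspace T | F `&` W !=set0].
Proof. by move=> oW; apply: fell_subbase_open; left; exists W. Qed.

Lemma fell_hit_closed (K : set T) :
  compact K -> closed [set F : hyperspace T | F `&` K !=set0].
Proof.
move=> cK; rewrite -[X in closed X]setCK closedC; apply: fell_subbase_open.
right; exists K => //; apply/seteqP; split => F /=.
  by move=> FK0; apply/nonemptyPn.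
by move/nonemptyPn.
Qed.

(** A point is compact; when it is also open, hitting it is both a closed and an open condition. *)
Lemma fell_mem_clopen (t : T) : open [set t] -> clopen [set F : hyperspace T | `[< hyper_set F t >]].
Proof.
move=> ot; rewrite (_ : [set _ | _] = [set F : hyperspace T | F `&` [set t] !=set0]).
  by split; [exact: fell_hit_open|apply: fell_hit_closed; exact: compact_set1].
apply/seteqP; split => F /= => [/asboolP Ft|[u [Fu ut]]]; first by exists t.
by apply/asboolP; rewrite -ut.
Qed.

Lemma fell_cvg (U : set_system (hyperspace T)) F : Filter U ->
  (forall A, fell_subbase A -> A F -> U A) -> U --> F.
Proof.
move=> FU UF A [B [[D sD <-] [C DC CF] BA]].
have [E EP EC] := sD _ DC.
apply: (@filterS _ U _ C); first by move=> F' CF'; apply: BA; exists C.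
rewrite -EC; apply: filter_bigI => i iE; apply: UF.
  by have := EP _ iE; rewrite inE.
by move: CF; rewrite -EC; exact.
Qed.

(** An ultrafilter [U] converges to the set [L] of points all of whose open neighbourhoods are hit
    by [U]-almost every closed set. *)
Lemma fell_compact : compact [set: hyperspace T].
Proof.
rewrite compact_ultra => U UU _.
pose L := [set t | forall W, open W -> W t ->
  U [set F : hyperspace T | F `&` W !=set0]].
have cL : closed L.
  move=> t clt W oW Wt; have [u [Lu Wu]] := clt W (open_nbhs_nbhs (conj oW Wt)).
  exact: Lu.
exists (Hyperspace cL); split => //; apply: fell_cvg => A.
move=> [[W oW <-] [t [Lt Wt]]|[K cK <-] LK]; first exact: Lt.
(* A point outside [L] has an open neighbourhood missed by [U]-almost every set; compactness of [K]
   then makes one member of [U] work for all of [K]. *)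
have KU t : K t -> \forall t' \near t & F \near U, ~ hyper_set F t'.
  move=> Kt; have nLt : ~ L t by move=> Lt; rewrite -[False]/(set0 t) -LK.
  have /existsNP[W /not_implyP[oW /not_implyP[Wt nU]]] := nLt.
  have [//|UW] := in_ultra_setVsetC [set F : hyperspace T | F `&` W !=set0] UU.
  exists (W, ~` [set F : hyperspace T | F `&` W !=set0]).
    by split => //; exact: open_nbhs_nbhs.
  by move=> [t' F] [/= Wt' FW Ft']; apply: FW; exists t'.
have /compact_near_coveringP/(_ _ U (fun F t => ~ hyper_set F t) _ KU) := cK.
by apply: filterS => F KF; apply/seteqP; split => // t [Ft Kt]; exact: (KF t).
Qed.

End FellSpace.

Lemma open_setX {S T : topologicalType} (A : set S) (B : set T) :
  open A -> open B -> open (A `*` B).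
Proof.
move=> oA oB; rewrite (_ : A `*` B = fst @^-1` A `&` snd @^-1` B) //.
by apply: openI; apply: open_comp => // p _; [exact: cvg_fst|exact: cvg_snd].
Qed.

Lemma open_set1_pair {S T : topologicalType} (s : S) (t : T) :
  open [set s] -> open [set t] -> open [set (s, t)].
Proof.
move=> os ot; rewrite (_ : [set (s, t)] = [set s] `*` [set t]).
  exact: open_setX.
by apply/seteqP; split => [_ ->|[u v] [/= -> ->]].
Qed.

(** * Bits on the Ellis and graph closures *)

Section Bits.
Local Open Scope ring_scope.
Variables (R : realType) (X : discreteTopologicalType).
Local Notation aX := (one_point_compactification X).
Local Notation bit_space := (prod_topology (fun _ : X * X => R)).
Variable G : groupClosed (permutation X).
Local Notation H := (subgroup G).

Definition bits (g : H) : bit_space := fun p => (val g p.1 == p.2)%:R.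

Definition bits_ext : extension H := closure_ext bits.

Lemma natr_bool_inj (b c : bool) : b%:R = c%:R :> R -> b = c.
Proof. by case: b c => [] [] // /eqP; rewrite ?oner_eq0 // eq_sym oner_eq0. Qed.

(** Indicators of clopen conditions are continuous, so they assemble into the comparison map; for
    each closure it remains to check compactness and separation by [b]. *)
Lemma bits_ext_eq {T : topologicalType} (e : H -> T) (b : T -> X * X -> bool) :
  compact (closure (range e)) ->
  (forall p, clopen [set t | b t p]) ->
  (forall g p, b (e g) p = (val g p.1 == p.2)) ->
  (forall t u, closure (range e) t -> closure (range e) u -> b t =1 b u -> t = u) ->
  ext_eq (closure_ext e) bits_ext.
Proof.
move=> cK cb be bI.
apply: (@closure_ext_eq _ _ _ e bits (fun t p => (b t p)%:R : R)) => //.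
- apply: prod_topology_hausdorff => _; exact: Rhausdorff.
- by apply: prod_topology_continuous => p; exact: clopen_natr_continuous.
- move=> t u Kt Ku tu; apply: bI => // p.
  by apply: natr_bool_inj; exact: (congr1 (fun f => f p) tu).
- by move=> g; apply/funext => p; rewrite be.
Qed.

Lemma opc_clopen_some (x : X) : clopen [set (Some x : aX)].
Proof.
split; last exact/accessible_closed_set1/hausdorff_accessible/opc_hausdorff.
rewrite -image_set1; apply: one_point_compactification_open_some.
exact: discrete_open.
Qed.

Lemma ellis_bits : ext_eq (ellis_opc G) bits_ext.
Proof.
apply: (@bits_ext_eq (prod_topology (fun _ : aX => aX)) _
  (fun t p => t (Some p.1) == Some p.2)).
- apply: (@subclosed_compact _ _
    [set f : prod_topology (fun _ : aX => aX) | forall i, [set: aX] (f i)]) => //.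
    exact: closed_closure.
  apply: (@prod_topology_compact aX (fun=> aX) (fun=> setT)) => _.
  exact: one_point_compactification_compact.
- move=> [x y]; have := opc_clopen_some y.
  move=> /preimage_clopen/(_ (eval_continuous (fun _ : aX => aX) (Some x))).
  by congr clopen; apply/seteqP; split => t /= /eqP.
- by move=> g p /=.
- move=> t u Kt Ku tu.
  (* No bit involves infinity, so the value there is settled by a closed condition that holds on
     [G]. *)
  have fixN v : closure (range (fun g : H => perm_opc (val g) :
      prod_topology (fun _ : aX => aX))) v -> v None = None.
    apply: (@closure_range_sub _ _ _
      ((fun v : prod_topology (fun _ : aX => aX) => v None) @^-1` [set None])) => //.
    apply: preimage_closed; first by move=> w _; exact: (eval_continuous (fun=> aX) None).
    exact/accessible_closed_set1/hausdorff_accessible/opc_hausdorff.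
  apply/funext => -[x|]; last by rewrite !fixN.
  case tx : (t (Some x)) => [y|].
    by have := tu (x, y); rewrite /= tx eqxx => /esym/eqP.
  case ux : (u (Some x)) => [y|] //.
  by have := tu (x, y); rewrite /= tx ux eqxx.
Qed.

(** The bits of [F] are its membership function, so they separate all closed sets, limits of graphs
    or not. *)
Lemma graph_discrete_bits : ext_eq (graph_discrete G) bits_ext.
Proof.
apply: (@bits_ext_eq _ _ (fun (F : hyperspace (X * X)%type) p => `[< hyper_set F p >])).
- apply: (subclosed_compact _ fell_compact) => //; exact: closed_closure.
- move=> [x y]; apply: fell_mem_clopen.
  apply: open_set1_pair; exact: discrete_open.
- move=> g [x y] /=; apply/asboolP/eqP => [[z _ [-> <-]] //|<-].
  by exists x.
- move=> F F' _ _ FF'; apply/hyperspace_inj/seteqP.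
  by split => p; case: (asbool_eq_equiv (FF' p)).
Qed.

Let line_l (x : X) : set (aX * aX) := [set Some x] `*` setT.
Let line_r (x : X) : set (aX * aX) := setT `*` [set Some x].

Let opc_graphs : set (hyperspace (aX * aX)%type) := range (fun g : H =>
  Hyperspace (graph_closed opc_hausdorff (@perm_opc_continuous X (val g)))).

(** Closed conditions pass from graphs to limits. The first three clauses come from hitting a
    compact set: a point, or a line, which is compact because [aX] is. The last comes from missing
    an open set. *)
Let graph_opc_closure (F : hyperspace (aX * aX)%type) :
    closure opc_graphs F ->
  [/\ hyper_set F (None, None),
      forall x, exists z, hyper_set F (Some x, z),
      forall y, exists z, hyper_set F (z, Some y)
    & forall x y z, hyper_set F (Some x, Some y) ->
      (hyper_set F (Some x, z) -> z = Some y) /\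
      (hyper_set F (z, Some y) -> z = Some x)].
Proof.
have oX (x : X) : open [set (Some x : aX)] by have [] := opc_clopen_some x.
have oCX (x : X) : open (~` [set (Some x : aX)]).
  by rewrite openC; have [] := opc_clopen_some x.
move=> KF; split.
- suff [p [Fp <-]] : F `&` [set (None, None)] !=set0 by [].
  move: F KF; apply: closure_range_sub.
    by apply: fell_hit_closed; exact: compact_set1.
  by move=> g; exists (None, None); split => //; exists None.
- move=> x; suff [[u z] [Fp [/= <- _]]] : F `&` line_l x !=set0 by exists z.
  move: F KF; apply: closure_range_sub.
    apply: fell_hit_closed; apply: compact_setX; first exact: compact_set1.
    exact: one_point_compactification_compact.
  by move=> g; exists (Some x, Some (val g x)); split => //; exists (Some x).
- move=> y; suff [[z u] [Fp [/= _ <-]]] : F `&` line_r y !=set0 by exists z.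
  move: F KF; apply: closure_range_sub.
    apply: fell_hit_closed; apply: compact_setX; last exact: compact_set1.
    exact: one_point_compactification_compact.
  move=> g; exists (Some (perm_inv (val g) y), Some y); split => //.
  by exists (Some (perm_inv (val g) y)); rewrite //= perm_invK.
- move=> x y z Fxy.
  (* As [(Some x, Some y)] is an open point, avoiding it or missing [W] is a closed condition. It
     holds for all graphs, hence for [F], which does contain the point. *)
  have miss (W : set (aX * aX)) : open W ->
      (forall g : H, val g x = y -> graph (perm_opc (val g)) `&` W = set0) ->
      hyper_set F `&` W = set0.
    move=> oW gW.
    suff : (~` [set F' : hyperspace (aX * aX)%type | F' `&` [set (Some x, Some y)] !=set0]
        `|` ~` [set F' : hyperspace (aX * aX)%type | F' `&` W !=set0]) F.
      by case=> [/= []|/= /nonemptyPn //]; exists (Some x, Some y).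
    move: F KF {Fxy}; apply: closure_range_sub.
      apply: closedU; rewrite closedC; last exact: fell_hit_open.
      by apply/fell_hit_open/open_set1_pair.
    move=> g /=; have [gxy|gxy] := eqVneq (val g x) y.
      by right; rewrite gW // => -[].
    left => -[_ [[_ _ <-] /= [-> [yE]]]]; by rewrite yE eqxx in gxy.
  split => Fz; apply: contrapT => zy.
  (* A graph through the point misses this set because it is single-valued; the symmetric case below
     uses injectivity of [g]. *)
  + suff h : hyper_set F `&` ([set Some x] `*` ~` [set Some y]) = set0.
      by rewrite -[False]/(set0 (Some x : aX, z)) -h.
    apply: miss; first exact: open_setX.
    move=> g gxy; apply/seteqP; split => // -[u v] [[_ _ [<- <-]] [/= -> []]].
    by rewrite /= gxy.
  + suff h : hyper_set F `&` (~` [set Some x] `*` [set Some y]) = set0.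
      by rewrite -[False]/(set0 (z, Some y : aX)) -h.
    apply: miss; first exact: open_setX.
    move=> g gxy; apply/seteqP; split => // -[u v] [[[w|] _ [<- <-]] [/= + //]].
    move=> + [wE]; apply; congr Some; apply: (can_inj (perm_funK (val g))).
    by rewrite gxy.
Qed.

Lemma graph_opc_bits : ext_eq (graph_opc G) bits_ext.
Proof.
apply: (@bits_ext_eq _ _ (fun (F : hyperspace (aX * aX)%type) p =>
  `[< hyper_set F (Some p.1, Some p.2) >])).
- apply: (subclosed_compact _ fell_compact) => //; exact: closed_closure.
- move=> [x y]; apply: fell_mem_clopen.
  by apply: open_set1_pair; [have [] := opc_clopen_some x|have [] := opc_clopen_some y].
- move=> g [x y] /=; apply/asboolP/eqP => [[_ _ [-> [<-]]] //|<-].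
  by exists (Some x).
- suff sub (F F' : hyperspace (aX * aX)%type) :
    closure opc_graphs F -> closure opc_graphs F' ->
    (forall x y, hyper_set F (Some x, Some y) <-> hyper_set F' (Some x, Some y)) ->
    hyper_set F `<=` hyper_set F'.
    move=> F F' KF KF' FF'.
    have {}FF' x y : hyper_set F (Some x, Some y) <-> hyper_set F' (Some x, Some y).
      by apply: asbool_eq_equiv; exact: FF' (x, y).
    apply/hyperspace_inj/seteqP; split; apply: sub => // x y.
    by case: (FF' x y).
  move=> /graph_opc_closure[_ _ _ F1] /graph_opc_closure[F'NN F'l F'r _] FF'.
  move=> [[x|] [y|]] Fxy //.
  + exact/FF'.
  (* [F'] meets the line over [x]. At a finite point [(x, y)], the common trace would put that point
     in [F] as well, and [F1] would exclude [(x, oo)] from [F]. The next case does the same with the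
     line at height [y]. *)
  + have [[y|] // F'xy] := F'l x.
    by have [/(_ Fxy)] := F1 _ _ None ((FF' x y).2 F'xy).
  + have [[x|] // F'xy] := F'r y.
    by have [_ /(_ Fxy)] := F1 _ _ None ((FF' x y).2 F'xy).
Qed.

End Bits.

(** * Double cosets and the Roelcke compactification *)

Section RoelckeBits.
Local Open Scope ring_scope.
Variables (R : realType) (X : discreteTopologicalType).
Variable G : groupClosed (permutation X).
Local Notation H := (subgroup G).

Lemma nbhs1_subgroup_perm (O : set H) : nbhs (1%g : H) O <->
  exists s : seq X, forall h : H, {in s, forall x, val h x = x} -> O h.
Proof.
split.
  move=> [_ [[C oC <-] C1 CO]].
  have /nbhs_perm[s sC] : nbhs (1%g : permutation X) C by exact: open_nbhs_nbhs.
  exists s => h hs; apply: CO; apply: sC.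
  by apply/eq_in_map => x /hs.
move=> [s sO]; have n1 : nbhs (1%g : permutation X)
    [set g | {in s, forall x, g x = x}].
  by apply/nbhs_perm; exists s => h /eq_in_map hs x /hs.
have : nbhs (1%g : H) [set h : H | {in s, forall x, val h x = x}].
  exact: (@subgroup_val_continuous _ G 1%g _ n1).
by apply: filterS.
Qed.

(* With [b = c^-1] and [a = h c g^-1], it suffices that [c] fixes [s] pointwise
   and sends [g^-1 z] to [h^-1 z] for [z] in [s]; the hypothesis makes these
   prescriptions [k] consistent and injective. *)
Lemma ultratransitive_dcoset (g h : H) (s : seq X) : ultratransitive G ->
  {in s &, forall x y, (val g x == y) = (val h x == y)} ->
  exists a b : H, [/\ {in s, forall x, val a x = x},
    {in s, forall x, val b x = x} & (h = a * g * b)%g].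
Proof.
move=> utG gh.
pose k x := if x \in s then x else perm_inv (val h) (val g x).
pose D := undup (s ++ map (perm_inv (val g)) s).
have Ds x : x \in s -> x \in D by move=> xs; rewrite mem_undup mem_cat xs.
have Dg z : z \in s -> perm_inv (val g) z \in D.
  by move=> zs; rewrite mem_undup mem_cat map_f ?orbT.
have DgP x : x \in D -> x \notin s -> val g x \in s.
  rewrite mem_undup mem_cat => /orP[->//|/mapP[z zs ->] _].
  by rewrite perm_invK.
(* The mixed case of injectivity: [k x = k x'] says [h x = g x'], and since [g x'] lies in [s] the
   hypothesis turns this into [g x = g x']. *)
have kC x x' : x' \in D -> x \in s -> x' \notin s -> k x <> k x'.
  move=> x'D xs x's; rewrite /k xs (negbTE x's) => xE.
  have : val h x == val g x' by rewrite xE perm_invK.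
  rewrite -gh ?DgP // => /eqP gxx'; move: x's.
  by rewrite -(can_inj (perm_funK (val g)) gxx') xs.
have kI : {in D &, injective k}.
  move=> x x' xD x'D kk; have [xs|xs] := boolP (x \in s); have [x's|x's] := boolP (x' \in s).
  - by move: kk; rewrite /k xs x's.
  - by have := kC _ _ x'D xs x's kk.
  - by have := kC _ _ xD x's xs (esym kk).
  - move: kk; rewrite /k (negbTE xs) (negbTE x's).
    by move=> /(can_inj (perm_invK (val h)))/(can_inj (perm_funK (val g))).
have [||c cG cP] := utG (size D) (tnth (in_tuple D)) (k \o tnth (in_tuple D)).
- by apply/tuple_uniqP; exact: undup_uniq.
- move=> i j /= /kI ij; suff /tuple_uniqP : uniq (in_tuple D) by apply; apply: ij; exact: mem_tnth.
  exact: undup_uniq.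
have {}cP x : x \in D -> c x = k x.
  by move=> /(tnthP (in_tuple D))[i ->]; exact: cP.
have cs x : x \in s -> c x = x by move=> xs; rewrite cP ?Ds // /k xs.
(* The two prescriptions may overlap: if [g^-1 z] is in [s], the hypothesis gives [h (g^-1 z) = z],
   so fixing it is also sending it to [h^-1 z]. *)
have cg z : z \in s -> c (perm_inv (val g) z) = perm_inv (val h) z.
  move=> zs; rewrite cP ?Dg // /k perm_invK; case: ifPn => // gzs.
  have : val g (perm_inv (val g) z) == z by rewrite perm_invK.
  by rewrite gh // => /eqP {2}<-; rewrite perm_funK.
pose c' : H := exist _ c cG.
exists (h * c' * g^-1)%g, (c'^-1)%g; split.
- by move=> z zs /=; rewrite cg // perm_invK.
- by move=> x xs /=; rewrite -[in LHS](cs x xs) perm_funK.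
- by rewrite mulgVK mulgK.
Qed.

(** Let [O] be the stabilizer of [x] and [y]. In [a g b] with [a], [b] in [O], [b] fixes [x] and [a]
    fixes [y], so the bit is constant on each [O g O]. *)
Lemma bit_unif_continuous (p : X * X) :
  [set f : roelcke H -> R | unif_continuous f /\ forall g, 0 <= f g <= 1]
    (fun g => bits R X G g p).
Proof.
case: p => x y; split => [A eA|g /=]; last first.
  by rewrite ler0n lern1 leq_b1.
pose O := [set a : H | val a x = x /\ val a y = y].
exists O.
  apply/nbhs1_subgroup_perm; exists [:: x; y] => h hs.
  by split; apply: hs; rewrite !inE eqxx ?orbT.
have bitO (g k : H) : dcoset O g k -> (val k x == y) = (val g x == y).
  move=> [a [_ ay] [b [bx _] <-]] /=; rewrite bx -{1}ay.
  exact/inj_eq/can_inj/perm_funK.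
move=> [k l] [g [kO lO]].
by rewrite /preimage /= /bits /= (bitO g k kO) (bitO g l lO); exact: entourage_refl.
Qed.

Lemma natr_bool_near (w : R) (b c : bool) :
  `|w - b%:R| < 2^-1 -> `|w - c%:R| < 2^-1 -> b = c.
Proof. by rewrite !ltr_norml; case: b c => [] [] //= /andP[? ?] /andP[? ?]; lra. Qed.

Lemma roelcke_bits : ultratransitive G ->
  ext_eq (roelcke_ext R H) (bits_ext R X G).
Proof.
move=> utG.
(* Each bit is itself a coordinate of the Samuel product, so the comparison map is a projection. *)
pose bit (p : X * X) : unif_fun R (roelcke H) :=
  @exist (roelcke H -> R) _ (fun g => bits R X G g p)
    (mem_set (bit_unif_continuous p)).
apply: (@closure_ext_eq _ (prod_topology (fun _ : unif_fun R (roelcke H) => R))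
  (prod_topology (fun _ : X * X => R)) (@samuel_map R (roelcke H)) (bits R X G)
  (fun t p => t (bit p))).
- apply: prod_topology_hausdorff => _; exact: Rhausdorff.
- have cI : compact [set t : prod_topology (fun _ : unif_fun R (roelcke H) => R) |
      forall f, `[0, 1]%classic (t f)].
    apply: (@prod_topology_compact _ (fun=> R) (fun=> `[0, 1]%classic)) => _.
    exact: segment_compact.
  apply: (subclosed_compact _ cI); first exact: closed_closure.
  apply: closure_range_sub.
    apply: compact_closed cI; apply: prod_topology_hausdorff => _; exact: Rhausdorff.
  move=> g f /=; rewrite in_itv /=.
  by have [_] := set_mem (valP f); exact.
- by apply: prod_topology_continuous => p; exact: (eval_continuous (fun=> R) (bit p)).
- move=> t u Kt Ku tu; apply/funext => f.
  apply/eqP; rewrite -subr_eq0 -normr_le0; apply/ler_addgt0Pr => e e0; rewrite add0r.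
  (* One third each for replacing [t] by [g], [g] by [h], and [h] by [u] at the coordinate [f]. *)
  have e3 : 0 < e / 3 by rewrite divr_gt0.
  have [fu _] := set_mem (valP f).
  have [V /nbhs1_subgroup_perm[s sV] Vf] := fu _ (entourage_ball R (PosNum e3)).
  (* Only finitely many coordinates are constrained: [f] and the bits over [s * s]. The bound 1/2
     suffices to round a coordinate to a bit. *)
  have near_bits v : closure (range (@samuel_map R (roelcke H))) v -> exists g : H,
      `|v f - val f g| < e / 3 /\
      {in s &, forall x y, `|v (bit (x, y)) - (val g x == y)%:R| < 2^-1}.
    move=> Kv.
    have near_eval i d : 0 < d -> \forall w \near v, `|v i - w i| < d.
      by move/cvgrPdist_lt : (eval_continuous (fun=> R) i v) => /(_ d).
    have near_evals (l : seq (X * X)) :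
        \forall w \near v, all (fun p => `|v (bit p) - w (bit p)| < 2^-1) l.
      elim: l => [|p l IH]; first exact: filterS filterT.
      have n1 := near_eval (bit p) 2^-1 ltac:(by rewrite invr_gt0).
      by apply: filterS2 n1 IH => w /= -> ->.
    have [_ [[g _ <-] [gf gs]]] :=
      Kv _ (filterI (near_eval f _ e3) (near_evals [seq (x, y) | x <- s, y <- s])).
    exists g; split => // x y xs ys.
    by apply: (allP gs (x, y)); exact: allpairs_f.
  have [g [gf gs]] := near_bits _ Kt.
  have [h [hf hs]] := near_bits _ Ku.
  have gh : {in s &, forall x y, (val g x == y) = (val h x == y)}.
    move=> x y xs ys; apply: (natr_bool_near (t (bit (x, y)))); first exact: gs.
    by rewrite (congr1 (fun r => r (x, y)) tu); exact: hs.
  have [a [b [as_ bs hE]]] := ultratransitive_dcoset g h s utG gh.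
  (* Both [g = 1 g 1] and [h = a g b] lie in [dcoset V g], since [V] contains the pointwise
     stabilizer of [s]. *)
  have /Vf /= ghf : dcoset_rel V (g, h).
    exists g; split => /=.
      by exists 1%g; [exact: sV|exists 1%g; [exact: sV|rewrite mul1g mulg1]].
    by exists a; [exact: sV|exists b; [exact: sV|]].
  rewrite /ball /= in ghf.
  have -> : t f - u f = (t f - val f g) + (val f g - val f h) - (u f - val f h) by ring.
  apply: (le_trans (ler_normB _ _)); apply: (le_trans (lerD (ler_normD _ _) (lexx _))).
  by lra.
- by [].
Qed.

End RoelckeBits.

Theorem theorem4p8 (R : realType) (X : discreteTopologicalType)
    (G : groupClosed (permutation X)) :
  infinite_set [set: X] -> ultratransitive G ->
  [/\ ext_eq (roelcke_ext R (subgroup G)) (ellis_opc G),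
      ext_eq (ellis_opc G) (graph_opc G)
    & ext_eq (graph_opc G) (graph_discrete G)].
Proof.
move=> _ utG; split.
- exact: ext_eq_trans (roelcke_bits R X G utG) (ext_eq_sym _ _ (ellis_bits R X G)).
- exact: ext_eq_trans (ellis_bits R X G) (ext_eq_sym _ _ (graph_opc_bits R X G)).
- exact: ext_eq_trans (graph_opc_bits R X G)
    (ext_eq_sym _ _ (graph_discrete_bits R X G)).
Qed.
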